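(* Let $H\subseteq\overline\Omega$ be relatively open and admissible with respect to $D$. Then there exists a fine representation $\{U_m\}_{m\in\mathbb N}$ for $H$ such that (i) $U_m$ is a Lipschitz domain for all $m\in\mathbb N$, and (ii) $\mathcal H^{n-1}(\partial U_m\cap D)>0$ for all $m\in\mathbb N$.
   Context: $\Omega\subseteq\mathbb R^n$ is a bounded Lipschitz domain and $D\subseteq\partial\Omega$ satisfies $\mathcal H^{n-1}(D)>0$. $U\subset\subset H$ means that $\overline U$ is compact and contained in $H$. A relatively open $H\subseteq\overline\Omega$ is admissible with respect to $D$ if for every $x\in H$ the set $P_H(x)$ of all $y\in H$ that can be joined to $x$ by a path in $H$ satisfies $\mathcal H^{n-1}(P_H(x)\cap D)>0$. A fine representation for a relatively open set $H\subseteq\overline\Omega$ is a countable family $\{U_k\}$ of open sets $U_k\subset\subset H$ such that for every $x\in H$ there exist an open set $U\subseteq\mathbb R^n$ with $x\in U$ and a $k\in\mathbb N$ with $U\cap\Omega\subseteq U_k$. *)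

(* Defs.v *)
From HB Require Import structures.
From mathcomp Require Import all_boot all_order all_algebra.
From mathcomp Require Import all_classical all_reals all_analysis.

Set Implicit Arguments.
Unset Strict Implicit.
Unset Printing Implicit Defensive.

Import Order.TTheory GRing.Theory Num.Theory.
Import numFieldNormedType.Exports.

Local Open Scope classical_set_scope.
Local Open Scope ring_scope.

(* The library norm and topology on 'rV[R]_n are those of the sup norm.  The
   topology is the usual one; distances and diameters are taken Euclidean. *)
Definition enorm (R : realType) (n : nat) (x : 'rV[R]_n) : R :=
  Num.sqrt (\sum_(i < n) x 0 i ^+ 2).

Section hausdorff.
Context {R : realType} {n : nat}.
Local Open Scope ereal_scope.

(* Equal to -oo on the empty set. *)
Definition ediam (A : set 'rV[R]_n) : \bar R :=
  ereal_sup [set (enorm (p.1 - p.2)%R)%:E | p in A `*` A].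

(* The empty set has gauge 0, also for s = 0; a nonempty set has gauge 1 for
   s = 0, so that the 0-dimensional measure is the counting measure. *)
Definition hausdorff_gauge (s : nat) (A : set 'rV[R]_n) : \bar R :=
  if A == set0 then 0 else ediam A ^+ s.

Definition hausdorff_pre (s : nat) (delta : R) (A : set 'rV[R]_n) : \bar R :=
  ereal_inf [set \sum_(k <oo) hausdorff_gauge s (F k) | F in
    [set F : (set 'rV[R]_n)^nat |
      A `<=` \bigcup_k F k /\ forall k, ediam (F k) <= delta%:E]].

(* Unnormalized: the constant factor (the volume of the ball of radius 1/2 in
   dimension s), which some authors include, is omitted. *)
Definition hausdorff_measure (s : nat) (A : set 'rV[R]_n) : \bar R :=
  ereal_sup [set hausdorff_pre s delta A | delta in [set d : R | (0 < d)%R]].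

End hausdorff.

Definition boundary {T : topologicalType} (A : set T) : set T :=
  closure A `\` interior A.

(* The ambient space is 'rV[R]_n.+1, so that the dimension is at least 1 and
   a point splits into its first n coordinates and its last one. *)
Section lipschitz_domain.
Context {R : realType} {n : nat}.

Definition first_coords (y : 'rV[R]_n.+1) : 'rV[R]_n :=
  \row_(i < n) y 0 (widen_ord (leqnSn n) i).

(* After an orthogonal change of coordinates, A is, near x0, the region above
   the graph of a Lipschitz function of the first n coordinates. *)
Definition lipschitz_graph_near (A : set 'rV[R]_n.+1) (x0 : 'rV[R]_n.+1) :=
  exists (Q : 'M[R]_n.+1) (g : 'rV[R]_n -> R) (L : R),
    [/\ Q *m Q^T = 1%:M,
        forall a b : 'rV[R]_n, `|g a - g b| <= L * enorm (a - b) &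
        \forall x \near x0,
          A x <-> g (first_coords (x *m Q)) < (x *m Q) 0 ord_max].

Definition lipschitz_domain (A : set 'rV[R]_n.+1) :=
  [/\ open A, connected A, A !=set0 &
      forall x0, boundary A x0 -> lipschitz_graph_near A x0].

End lipschitz_domain.

Section fine_representation.
Context {R : realType} {n : nat}.
Implicit Types (Omega D H U : set 'rV[R]_n.+1).

Definition relatively_open Omega H :=
  exists2 O, open O & H = closure Omega `&` O.

Definition compactly_contained U H :=
  compact (closure U) /\ closure U `<=` H.

Definition path_component H (x : 'rV[R]_n.+1) : set 'rV[R]_n.+1 :=
  [set y | exists g : R -> 'rV[R]_n.+1,
     [/\ {within `[0, 1], continuous g}, g 0 = x, g 1 = y &
         forall t, t \in `[0, 1] -> H (g t)]].

Definition admissible D H :=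
  forall x, H x -> (0 < hausdorff_measure n (path_component H x `&` D))%E.

Definition fine_representation Omega H (U : (set 'rV[R]_n.+1)^nat) :=
  (forall k, open (U k) /\ compactly_contained (U k) H) /\
  (forall x, H x -> exists V k, [/\ open V, V x & V `&` Omega `<=` U k]).

End fine_representation.

(* Main.v *)
Require Import Defs.
From mathcomp Require Import all_boot all_order all_algebra.
From mathcomp Require Import all_classical all_reals all_analysis.
From mathcomp Require Import ring lra zify.
Import Order.TTheory GRing.Theory Num.Theory.
Import numFieldNormedType.Exports.
Local Open Scope classical_set_scope.
Local Open Scope ring_scope.

(* An open set is a Lipschitz domain near a boundary point [p] exactly when it
   is star-shaped near [p] with respect to a small ball around some point [q]
   ([star_near] below).  This property passes to unions and intersections that
   share the pair [p], [q], and convex sets have it for every [p] and every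
   point [q] of theirs.  Hence a connected Lipschitz [U] inside [Omega] can be
   enlarged along a segment [a, b] with [b] in [U]: if [y] is the first point of
   the segment in the closure of [U], add a small convex set around [y] and the
   part of [Omega] in a thin tube around [a, y].  Given [x] in [H], start with
   such a tube at a point [z] of [D] in the path component of [x] around which
   [D] has positive measure, propagate to the points of [Omega] along the path
   from [z] to [x], and if [x] lies on the boundary of [Omega] attach one more
   tube issuing from [x].  A countable base of the topology then selects
   countably many of these domains. *)

(** * Local star-shapedness *)

Section star_near.
Context {R : realType} {n : nat}.
Notation V := 'rV[R]_n.+1.
Implicit Types (A B N : set V) (a b p q y : V).

Lemma open_ballP A p : open A -> A p ->
  exists2 e : R, 0 < e & forall w, `|w - p| < e -> A w.
Proof.
move=> oA Ap; have /nbhs_normP[e /= e0 He] := open_nbhs_nbhs (conj oA Ap).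
by exists e => // w we; apply: He; rewrite /= distrC.
Qed.

Lemma ball_openP A : (forall p, A p ->
  exists2 e : R, 0 < e & forall w, `|w - p| < e -> A w) -> open A.
Proof.
move=> HA; rewrite openE => p Ap; have [e e0 He] := HA p Ap.
by apply/(nbhs_normP p A); exists e => //= w; rewrite /= distrC; exact: He.
Qed.

Lemma closure_ballP A p : closure A p <->
  forall e : R, 0 < e -> exists2 w, A w & `|w - p| < e.
Proof.
split=> [cA e e0|H B /nbhs_normP[e /= e0 He]].
  have /cA[w [Aw we]] : nbhs p [set w | `|p - w| < e].
    by apply/(nbhs_normP p [set w | `|p - w| < e]); exists e.
  by exists w => //; rewrite distrC.
have [w Aw we] := H e e0; exists w; split=> //.
by apply: He; rewrite /= distrC.
Qed.

Lemma not_closure_ball A p : ~ closure A p ->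
  exists2 e : R, 0 < e & forall w, `|w - p| < e -> ~ A w.
Proof.
move=> nA; have oC : open (~` closure A) by apply: closed_openC; exact: closed_closure.
have [e e0 He] := open_ballP _ _ oC nA; exists e => // w /He nw Aw.
by apply: nw; exact: subset_closure.
Qed.

(** The point [p] need not lie in [A]. If it lies in the closure, taking [t = 1] shows that a ball
    around [q] is contained in [A]; off the closure the condition is vacuous for small [e]. *)
Definition star_near A p q := exists2 e : R, 0 < e &
  forall w q' t, `|w - p| < e -> `|q' - q| < e -> A w -> 0 <= t <= 1 ->
    A (w + t *: (q' - w)).

Lemma star_near_setU A B p q :
  star_near A p q -> star_near B p q -> star_near (A `|` B) p q.
Proof.
move=> [e e0 He] [f f0 Hf]; exists (Num.min e f); first by rewrite lt_min e0.
move=> w q' t; rewrite !lt_min => /andP[we wf] /andP[qe qf] [Aw|Bw] t01.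
  by left; exact: He.
by right; exact: Hf.
Qed.

Lemma star_near_setI A B p q :
  star_near A p q -> star_near B p q -> star_near (A `&` B) p q.
Proof.
move=> [e e0 He] [f f0 Hf]; exists (Num.min e f); first by rewrite lt_min e0.
move=> w q' t; rewrite !lt_min => /andP[we wf] /andP[qe qf] [Aw Bw] t01.
by split; [exact: He|exact: Hf].
Qed.

Lemma star_near_outside A p q : ~ closure A p -> star_near A p q.
Proof.
by move=> /not_closure_ball[e e0 He]; exists e => // w q' t /He.
Qed.

Definition convex_body A := forall a b t, A a -> A b -> 0 <= t <= 1 ->
  A (a + t *: (b - a)).

Lemma convex_star_near A p q : open A -> convex_body A -> A q -> star_near A p q.
Proof.
move=> oA cA Aq; have [e e0 He] := open_ballP _ _ oA Aq.
by exists e => // w q' t _ /He Aq' Aw; exact: cA.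
Qed.


Lemma norm_ball_convex p (e : R) : convex_body [set w | `|w - p| < e].
Proof.
move=> a b t /= ae be /andP[t0 t1].
have -> : a + t *: (b - a) - p = (1 - t) *: (a - p) + t *: (b - p).
  by apply/rowP => i; rewrite !mxE; ring.
apply: le_lt_trans (ler_normD _ _) _; rewrite !normrZ.
by rewrite (ger0_norm t0) ger0_norm ?subr_ge0//; case: (ltrP 0 t) => ?; nra.
Qed.

Lemma norm_ball_open p (e : R) : open [set w : V | `|w - p| < e].
Proof.
apply: ball_openP => w /= we; exists (e - `|w - p|); first by rewrite subr_gt0.
by move=> z ze; have := ler_distD w z p; lra.
Qed.

Definition tube a b (d : R) : set V :=
  [set p | exists2 t, 0 <= t <= 1 & `|p - (a + t *: (b - a))| < d].

Lemma tube_open a b d : open (tube a b d).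
Proof.
apply: ball_openP => w [t t01 wd].
exists (d - `|w - (a + t *: (b - a))|); first by rewrite subr_gt0.
by move=> z ze; exists t => //; have := ler_distD w z (a + t *: (b - a)); lra.
Qed.

Lemma tube_convex a b d : convex_body (tube a b d).
Proof.
move=> p q s [t /andP[t0 t1] pd] [u /andP[u0 u1] qd] /andP[s0 s1].
exists (t + s * (u - t)); first by apply/andP; split; nra.
have -> : p + s *: (q - p) - (a + (t + s * (u - t)) *: (b - a)) =
  (1 - s) *: (p - (a + t *: (b - a))) + s *: (q - (a + u *: (b - a))).
  by apply/rowP => i; rewrite !mxE; ring.
apply: le_lt_trans (ler_normD _ _) _; rewrite !normrZ.
by rewrite (ger0_norm s0) ger0_norm ?subr_ge0//; case: (ltrP 0 s) => ?; nra.
Qed.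

Lemma tube_segment a b d t : 0 < d -> 0 <= t <= 1 -> tube a b d (a + t *: (b - a)).
Proof. by move=> d0 t01; exists t => //; rewrite subrr normr0. Qed.

Lemma tubel a b d : 0 < d -> tube a b d a.
Proof. by move=> d0; have := tube_segment a b d 0 d0; rewrite scale0r addr0; apply; lra. Qed.

Lemma tuber a b d : 0 < d -> tube a b d b.
Proof. by move=> d0; have := tube_segment a b d 1 d0; rewrite scale1r subrKC; apply; lra. Qed.

Lemma subset_tube a b d d' : d <= d' -> tube a b d `<=` tube a b d'.
Proof. by move=> dd' p [t t01 pd]; exists t => //; exact: lt_le_trans dd'. Qed.

Lemma closure_tube a b d d' : d < d' -> closure (tube a b d) `<=` tube a b d'.
Proof.
move=> dd' p /closure_ballP/(_ (d' - d))[|w [t t01 wd] wp].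
  by rewrite subr_gt0.
exists t => //; have := ler_distD w p (a + t *: (b - a)).
by rewrite (distrC p w); lra.
Qed.

Lemma tube_subset_open a b N : open N ->
  (forall t, 0 <= t <= 1 -> N (a + t *: (b - a))) ->
  exists2 d : R, 0 < d & tube a b d `<=` N.
Proof.
move=> oN HN.
have /compact_near_coveringP cpt := @segment_compact R 0 1.
have := cpt R (0 : R)^'+ (fun d t => forall p, `|p - (a + t *: (b - a))| < d -> N p) _.
case.
  move=> t /=; rewrite in_itv/= => t01.
  have [e e0 He] := open_ballP _ _ oN (HN t t01).
  (* Changing the parameter by less than [k] moves the point by at most [e / 2]; the summand [1]
     covers [a = b]. *)
  pose k := e / (2 * (1 + `|b - a|)).
  have k0 : 0 < k by rewrite divr_gt0// mulr_gt0// ltr_pwDl.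
  exists ([set s : R | `|t - s| < k], [set d : R | d <= e / 2]) => /=.
    split; last by apply: nbhs_right_le; rewrite divr_gt0.
    by apply/(nbhs_normP t [set s : R | `|t - s| < k]); exists k.
  move=> [s d] /= [ts de] p pd; apply: He.
  have -> : p - (a + t *: (b - a)) = (p - (a + s *: (b - a))) - (t - s) *: (b - a).
    by apply/rowP => i; rewrite !mxE; ring.
  apply: le_lt_trans (ler_normB _ _) _; rewrite normrZ.
  suff : `|t - s| * `|b - a| <= e / 2 by lra.
  have : k * (1 + `|b - a|) = e / 2.
    by rewrite /k; field; rewrite gt_eqF// ltr_pwDl.
  by have := normr_ge0 (b - a); nra.
move=> d /= d0 Hd; exists (d / 2); first by rewrite divr_gt0.
move=> p [t t01 pd]; apply: (Hd (d / 2)) pd => //=.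
- by rewrite sub0r normrN ger0_norm; lra.
- by rewrite divr_gt0.
Qed.

(** A cone with apex [y] around the segment to [q] lies in [A]: its points are reached from some [w]
    in [A] very close to [y] by shifting the target slightly. *)
Lemma star_near_segment A y q : closure A y -> star_near A y q ->
  exists2 e : R, 0 < e & forall t d, 0 < t <= 1 -> `|d| < t * e ->
    A (y + t *: (q - y) + d).
Proof.
move=> cA [e e0 He]; exists (e / 2) => [|t d /andP[t0 t1] de]; first by rewrite divr_gt0.
have [w Aw wy] : exists2 w, A w & `|w - y| < t * e / 2.
  by move/closure_ballP: cA; apply; rewrite divr_gt0// mulr_gt0.
(* The solution [q'] of [y + t *: (q - y) + d = w + t *: (q' - w)]. *)
pose q' := q + t^-1 *: d - (t^-1 * (1 - t)) *: (w - y).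
have -> : y + t *: (q - y) + d = w + t *: (q' - w).
  by apply/rowP => i; rewrite !mxE; field; rewrite gt_eqF.
apply: He => //; last by rewrite ltW.
  by apply: lt_le_trans wy _; nra.
have -> : q' - q = t^-1 *: (d - (1 - t) *: (w - y)).
  by apply/rowP => i; rewrite !mxE; field; rewrite gt_eqF.
rewrite normrZ ger0_norm ?invr_ge0 1?ltW// ltr_pdivrMl//.
apply: le_lt_trans (ler_normB _ _) _; rewrite normrZ ger0_norm ?subr_ge0//.
by have := normr_ge0 (w - y); nra.
Qed.

(* Aiming at a point [q1] close to [y] makes the star property uniform along a
   thin tube around [y, q1]: the half of the tube next to [q1] lies in [A], and
   from the half next to [y] the segments to [q1] point almost towards [q]. *)
Lemma star_near_tube A y q : closure A y -> star_near A y q ->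
  exists2 s0 : R, 0 < s0 <= 1 & forall s, 0 < s <= s0 ->
    A (y + s *: (q - y)) /\ exists2 d : R, 0 < d &
      forall p, tube y (y + s *: (q - y)) d p -> star_near A p (y + s *: (q - y)).
Proof.
move=> cA sA; have [f f0 Hf] := star_near_segment _ _ _ cA sA.
have [e e0 He] := sA.
pose v := q - y.
have v0 := normr_ge0 v.
exists (Num.min 1 (e / (4 * (1 + `|v|)))).
  by rewrite lt_min ltr01/= divr_gt0 ?mulr_gt0 ?ltr_pwDl//= ge_min lexx.
move=> s /andP[s0]; rewrite le_min => /andP[s1]; rewrite ler_pdivlMr ?mulr_gt0 ?ltr_pwDl// => se.
split; first by rewrite -[X in A X]addr0; apply: Hf; rewrite ?s0// normr0 mulr_gt0.
have sv : s * `|v| <= e / 4 by lra.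
(* The first bound serves the half of the tube next to the target, the other two the half next to
   [y]. *)
pose d := Num.min (s * f / 2) (Num.min (e / 8) (s * e / 16)).
have d0 : 0 < d.
  by rewrite /d !lt_min !divr_gt0 ?mulr_gt0.
have [d1 d2 d3] : [/\ d <= s * f / 2, d <= e / 8 & d <= s * e / 16].
  by split; rewrite /d !ge_min lexx ?orbT.
exists (d / 2) => [|p [t' /andP[t'0 t'1] pd]]; first by rewrite divr_gt0.
exists (d / 2) => [|w q' u wp q'd Aw /andP[u0 u1]]; first by rewrite divr_gt0.
pose t := t' * s; pose x := w - (y + t *: v); pose z := q' - (y + s *: v).
have tE : y + t' *: (y + s *: (q - y) - y) = y + t *: v.
  by apply/rowP => i; rewrite !mxE /t; ring.
rewrite tE in pd.
have xd : `|x| < d.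
  by have := ler_distD p w (y + t *: v); rewrite /x; lra.
have zd : `|z| < d by rewrite /z; lra.
have [t0 ts] : 0 <= t /\ t <= s by split; rewrite /t; nra.
have -> : w = y + t *: v + x by apply/rowP => i; rewrite !mxE; ring.
have [ts2|ts2] := lerP t (s / 2); last first.
  have -> : y + t *: v + x + u *: (q' - (y + t *: v + x)) =
     y + (t + u * (s - t)) *: (q - y) + ((1 - u) *: x + u *: z).
    by apply/rowP => i; rewrite !mxE; ring.
  apply: Hf; first by apply/andP; split; nra.
  apply: le_lt_trans (ler_normD _ _) _; rewrite !normrZ (ger0_norm u0).
  rewrite ger0_norm ?subr_ge0//.
  have : (1 - u) * `|x| + u * `|z| < d by case: (ltrP 0 u) => ?; nra.
  have : s / 2 * f <= (t + u * (s - t)) * f.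
    by rewrite ler_wpM2r ?(ltW f0)//; nra.
  by lra.
have wE : y + t *: v + x = w by apply/rowP => i; rewrite !mxE; ring.
rewrite wE.
have st0 : 0 < s - t by lra.
(* Up to an error below [2 * d], [q' - w] is [(s - t) *: (q - y)], so the rescaled segment ends near
   [q]; as [s - t >= s / 2], the error grows to at most [e / 4]. *)
pose q'' := w + (s - t)^-1 *: (q' - w).
have -> : w + u *: (q' - w) = w + (u * (s - t)) *: (q'' - w).
  by apply/rowP => i; rewrite !mxE; field; rewrite gt_eqF.
have wyE : w - y = t *: v + x by apply/rowP => i; rewrite !mxE; ring.
have wye : `|w - y| < e / 2.
  rewrite wyE; apply: le_lt_trans (ler_normD _ _) _.
  by rewrite normrZ (ger0_norm t0); nra.
apply: He => //; [lra| |]; last first.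
  apply/andP; split; first by rewrite mulr_ge0// ltW.
  by apply: mulr_ile1 => //; [exact: ltW|lra].
have -> : q'' - q = (w - y) + (s - t)^-1 *: (z - x).
  by apply/rowP => i; rewrite !mxE; field; rewrite gt_eqF.
apply: le_lt_trans (ler_normD _ _) _; rewrite normrZ.
rewrite ger0_norm ?invr_ge0 1?ltW//.
suff : (s - t)^-1 * `|z - x| <= e / 4 by lra.
rewrite ler_pdivrMl//; apply: le_trans (ler_normB _ _) _; nra.
Qed.

End star_near.

(** * Attaching tubes *)

Section star_domain.
Context {R : realType} {n : nat}.
Notation V := 'rV[R]_n.+1.
Implicit Types (A B N U Omega : set V) (a b p q y : V).

(** All [p] are allowed: points of [A] and points off its closure satisfy the condition anyway, so
    only boundary points matter. *)
Definition star_domain A :=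
  [/\ open A, connected A & forall p, exists q, star_near A p q].

Lemma star_near_interior A p : open A -> A p -> star_near A p p.
Proof.
move=> oA Ap; have [e e0 He] := open_ballP _ _ oA Ap.
exists e => // w q' t we qe _ t01; apply: He.
exact: (norm_ball_convex p e w q' t).
Qed.

Lemma star_connected A y : A y ->
  (forall w t, A w -> 0 <= t <= 1 -> A (w + t *: (y - w))) -> connected A.
Proof.
move=> Ay HA.
have -> : A = \bigcup_(w in A) ((fun t : R => w + t *: (y - w)) @` `[0, 1]).
  apply/seteqP; split=> [w Aw|z [w Aw [t]]].
    by exists w => //; exists 0; rewrite ?scale0r ?addr0//= in_itv/= lexx ler01.
  by rewrite /= in_itv/= => t01 <-; exact: HA.
apply: bigcup_connected.
  by exists y => w Aw; exists 1; rewrite ?scale1r ?subrKC//= in_itv/= lexx ler01.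
move=> w Aw; apply: connected_continuous_connected; first exact: segment_connected.
apply: continuous_subspaceT => t.
by apply: cvgD; [exact: cvg_cst|apply: cvgZr_tmp; exact: cvg_id].
Qed.

Lemma convex_connected A y : convex_body A -> A y -> connected A.
Proof. by move=> cA Ay; apply: (star_connected _ y) => // w t Aw; exact: cA. Qed.

(** The freedom in [s] lets the target slide along the segment, as a tube issuing from a boundary
    point of [Omega] requires. *)
Lemma star_near_small_tube A N y q : closure A y -> star_near A y q ->
  open N -> N y ->
  exists2 s0 : R, 0 < s0 <= 1 & forall s, 0 < s <= s0 ->
    A (y + s *: (q - y)) /\ exists2 d : R, 0 < d &
      forall p, tube y (y + s *: (q - y)) d p ->
        N p /\ star_near A p (y + s *: (q - y)).
Proof.
move=> cA sA oN Ny; have [s0 /andP[s00 s01] Hs] := star_near_tube _ _ _ cA sA.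
have [e e0 He] := open_ballP _ _ oN Ny.
pose v := q - y; have v1 : 0 < 1 + `|v| by rewrite ltr_pwDl.
pose s1 := Num.min s0 (e / (1 + `|v|)).
exists s1; first by rewrite lt_min s00 divr_gt0//= ge_min s01.
move=> s /andP[sgt0]; rewrite le_min ler_pdivlMr// => /andP[ss0 se].
have [Aq [d d0 Hd]] := Hs _ (introT andP (conj sgt0 ss0)); split=> //.
have [|f f0 Hf] := tube_subset_open y (y + s *: v) _ oN.
  move=> t /andP[t0 t1]; apply: He.
  have -> : y + t *: (y + s *: v - y) - y = (t * s) *: v.
    by apply/rowP => i; rewrite !mxE; ring.
  rewrite normrZ ger0_norm ?mulr_ge0//; last exact: ltW.
  have : t * s <= s by nra.
  by have := normr_ge0 v; nra.
exists (Num.min d f) => [|p tp]; first by rewrite lt_min d0.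
split; first by apply: Hf; apply: subset_tube tp; rewrite ge_min lexx orbT.
by apply: Hd; apply: subset_tube tp; rewrite ge_min lexx.
Qed.

(** [B] is a thin tube from [y] to a point [q1] of [U]. Near the closure of [B], both [U] and [B]
    are star-shaped towards [q1]; elsewhere only [U] matters. *)
Lemma star_domain_bump U N y : star_domain U -> closure U y -> open N -> N y ->
  exists B, [/\ open B, convex_body B, B y, closure B `<=` N &
    star_domain (U `|` B)].
Proof.
move=> [oU cU sU] Uy oN Ny; have [q sq] := sU y.
have [s0 /andP[s00 _] /(_ s0)] := star_near_small_tube _ _ _ _ Uy sq oN Ny.
rewrite lexx s00 => /(_ isT)[Uq1 [d d0 Hd]]; set q1 := y + _ in Uq1 Hd.
have d2 : 0 < d / 2 by lra.
have dd : d / 2 < d by lra.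
have Bq1 := tuber y q1 _ d2.
(* Half the radius, so that the closure of [B] stays in the tube to which [Hd] applies. *)
exists (tube y q1 (d / 2)); split.
- exact: tube_open.
- exact: tube_convex.
- exact: tubel.
- by move=> p /(closure_tube _ _ _ _ dd)/Hd[].
- split; first by apply: openU => //; exact: tube_open.
    apply: connectedU => //; first by exists q1.
    by apply: (convex_connected _ q1) => //; exact: tube_convex.
  move=> p; have [Bp|nBp] := pselect (closure (tube y q1 (d / 2)) p).
    exists q1; apply: star_near_setU.
      by have [] := Hd _ (closure_tube _ _ _ _ dd _ Bp).
    by apply: convex_star_near => //; [exact: tube_open|exact: tube_convex].
  have [q2 Hq2] := sU p; exists q2; apply: star_near_setU => //.
  exact: star_near_outside.
Qed.

Lemma star_near_setI_tube Omega a y p d : 0 < d ->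
  star_near Omega p y -> star_near (Omega `&` tube a y d) p y.
Proof.
move=> d0 sp; apply: star_near_setI => //.
by apply: convex_star_near; [exact: tube_open|exact: tube_convex|exact: tuber].
Qed.

Lemma connected_setI_tube Omega a y d : 0 < d -> Omega y ->
  (forall p, tube a y d p -> star_near Omega p y) ->
  connected (Omega `&` tube a y d).
Proof.
move=> d0 Oy Hs; apply: (star_connected _ y); first by split=> //; exact: tuber.
move=> w t [Ow tw] t01.
have [e e0 He] := star_near_setI_tube _ a _ _ _ d0 (Hs _ tw).
by apply: He => //; rewrite ?subrr ?normr0.
Qed.

(** [U] is the part of [Omega] in a thin tube from [z] to a point [q1] of [Omega]: it is star-shaped
    with respect to [q1], hence connected, and agrees with [Omega] near [z]. *)
Lemma star_domain_corner Omega N z : star_domain Omega -> closure Omega z ->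
  open N -> N z ->
  exists U W, [/\ star_domain U, U !=set0, U `<=` Omega, closure U `<=` N &
    [/\ open W, W z & W `&` Omega `<=` U]].
Proof.
move=> [oO _ sO] Oz oN Nz; have [q sq] := sO z.
have [s0 /andP[s00 _] /(_ s0)] := star_near_small_tube _ _ _ _ Oz sq oN Nz.
rewrite lexx s00 => /(_ isT)[Oq1 [d d0 Hd]]; set q1 := z + _ in Oq1 Hd.
have d2 : 0 < d / 2 by lra.
have dd : d / 2 < d by lra.
have dd' := subset_tube z q1 _ _ (ltW dd).
have cU : closure (Omega `&` tube z q1 (d / 2)) `<=` tube z q1 d.
  by move=> p /(closure_subset (@subIsetr _ _ _)); exact: closure_tube.
exists (Omega `&` tube z q1 (d / 2)), (tube z q1 (d / 2)); split=> //.
- split; first by apply: openI => //; exact: tube_open.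
    by apply: connected_setI_tube => // p /dd'/Hd[].
  move=> p; have [Up|nUp] := pselect (tube z q1 d p); last first.
    by exists q1; apply: star_near_outside => /cU.
  by exists q1; apply: star_near_setI_tube => //; have [] := Hd _ Up.
- by exists q1; split=> //; exact: tuber.
- by move=> p /cU/Hd[].
- by split; [exact: tube_open|exact: tubel|rewrite setIC].
Qed.

Lemma first_hit a b U : closure U b ->
  exists2 t : R, 0 <= t <= 1 & closure U (a + t *: (b - a)) /\
    forall s, 0 <= s < t -> ~ closure U (a + s *: (b - a)).
Proof.
move=> Ub.
pose S := [set t : R | 0 <= t <= 1 /\ closure U (a + t *: (b - a))].
have S1 : S 1 by split; [lra|rewrite scale1r subrKC].
have lS : lbound S 0 by move=> t [/andP[]].
have iS : has_inf S by split; [exists 1|exists 0].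
have t0 : 0 <= inf S by apply: lb_le_inf => //; exists 1.
have t1 : inf S <= 1 by apply: ge_inf => //; exact: iS.2.
exists (inf S); first by rewrite t0.
split; last first.
  move=> s /andP[s0 sS] Us; have : inf S <= s; last by lra.
  by apply: ge_inf; [exact: iS.2|split=> //; lra].
apply: closed_closure; apply/closure_ballP => e e0.
pose k := e / (1 + `|b - a|).
have v1 : 0 < 1 + `|b - a| by rewrite ltr_pwDl.
have k0 : 0 < k by rewrite divr_gt0.
have [t [t01 Ut] tk] := inf_adherent k0 iS.
exists (a + t *: (b - a)) => //.
have -> : a + t *: (b - a) - (a + inf S *: (b - a)) = (t - inf S) *: (b - a).
  by apply/rowP => i; rewrite !mxE; ring.
have tS : inf S <= t by apply: (ge_inf iS.2); split.
rewrite normrZ ger0_norm ?subr_ge0//.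
have : k * (1 + `|b - a|) = e by rewrite /k; field; rewrite gt_eqF.
by have := normr_ge0 (b - a); nra.
Qed.

(** The bump [B] is a neighbourhood of the first hitting point [y], so a thin tube from [a] to [y]
    meets [closure U] only inside [B]. Off [closure U], the convex set [B] and the part of [Omega]
    in the tube share the target [y]. The condition on hits places [y] in [Omega], so that [B] fits
    into [Omega]. *)
Lemma star_domain_attach Omega N U a b : open Omega -> star_domain U ->
  U `<=` Omega -> U b -> open N ->
  (forall t, 0 <= t <= 1 -> N (a + t *: (b - a))) ->
  (forall t, 0 <= t <= 1 -> closure U (a + t *: (b - a)) -> Omega (a + t *: (b - a))) ->
  (forall t, 0 <= t <= 1 -> Omega (a + t *: (b - a)) -> exists2 d : R, 0 < d &
    forall p, tube a (a + t *: (b - a)) d p -> star_near Omega p (a + t *: (b - a))) ->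
  exists U' W, [/\ star_domain U', U `<=` U', U' `<=` Omega,
    closure U' `<=` closure U `|` (closure Omega `&` N) &
    [/\ open W, W a & W `&` Omega `<=` U']].
Proof.
move=> oO sU UO Ub oN HN hit HO.
have [t t01 [Uy before]] := first_hit a b U (subset_closure Ub).
have Oy := hit t t01 Uy; have [d d0 Hd] := HO t t01 Oy.
have Ny := HN t t01.
set y := a + t *: (b - a) in Uy Oy Hd Ny.
have [B [oB cB By BN [oUB cUB sUB]]] :=
  star_domain_bump U (Omega `&` N) y sU Uy (openI oO oN) (conj Oy Ny).
have oUc : open (~` closure U) by apply: closed_openC; exact: closed_closure.
have [||f f0 Hf] := tube_subset_open a y (N `&` (B `|` ~` closure U)).
- by apply: openI => //; exact: openU.
- move=> s /andP[s0 s1].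
  have -> : a + s *: (y - a) = a + (s * t) *: (b - a).
    by apply/rowP => i; rewrite !mxE; ring.
  move/andP: t01 => [t0 t1].
  split; first by apply: HN; apply/andP; split; nra.
  have [st|st] := ltrP (s * t) t; first by right; apply: before; rewrite st mulr_ge0.
  by left; have -> : s * t = t by nra.
(* [d] makes [Omega] star-shaped towards [y] along the tube; [f] keeps the tube off [closure U]
   outside [B]. *)
pose g := Num.min d f.
have g0 : 0 < g by rewrite lt_min d0.
have gd p : tube a y g p -> star_near Omega p y.
  by move=> tp; apply: Hd; apply: subset_tube tp; rewrite ge_min lexx.
have gf p : tube a y g p -> N p /\ (B p \/ ~ closure U p).
  by move=> tp; apply: Hf; apply: subset_tube tp; rewrite ge_min lexx orbT.
have g2 : 0 < g / 2 by lra.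
have gg : g / 2 < g by lra.
pose T0 := tube a y (g / 2).
have T0g := closure_tube a y _ _ gg.
have T0s := subset_tube a y _ _ (ltW gg).
have BO p : B p -> Omega p by move=> /subset_closure/BN[].
exists (U `|` B `|` (Omega `&` T0)), T0; split.
- split.
  + by apply: openU => //; apply: openI => //; exact: tube_open.
  + apply: connectedU => //.
      by exists y; split; [right|split=> //; exact: tuber].
    by apply: connected_setI_tube => // p /T0s/gd.
  + move=> p; have [tp|ntp] := pselect (closure T0 p); last first.
      have [q sq] := sUB p; exists q; apply: star_near_setU => //.
      by apply: star_near_outside => /(closure_subset (@subIsetr _ _ _)).
    have [Np [Bp|nUp]] := gf _ (T0g _ tp).
      (* Points of [B] are interior to the new domain, so no common target has to be found there. *)
      exists p; apply: star_near_interior; last by left; right.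
      by apply: openU => //; apply: openI => //; exact: tube_open.
    exists y; apply: star_near_setU.
      by apply: star_near_setU; [exact: star_near_outside|exact: convex_star_near].
    by apply: star_near_setI_tube => //; exact/gd/T0g.
- by move=> p Up; left; left.
- by move=> p [[/UO|/BO]|[]].
- rewrite !closureU => p [[Up|Bp]|Tp]; [by left|right|right].
    by have [Op Np] := BN _ Bp; split=> //; exact: subset_closure.
  split; first by move: p Tp; apply: closure_subset; exact: subIsetl.
  have Tp0 : closure T0 p by move: p Tp; apply: closure_subset; exact: subIsetr.
  by have [] := gf _ (T0g _ Tp0).
- by split; [exact: tube_open|exact: tubel|move=> p [Tp Op]; right].
Qed.

End star_domain.

(** * Lipschitz graphs and local star-shapedness *)

Section lipschitz_graph.
Context {R : realType} {n : nat}.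
Notation V := 'rV[R]_n.+1.
Implicit Types (A : set V) (p q x y d : V) (a b : 'rV[R]_n).

Lemma normr_coord m (x : 'rV[R]_m) i : `|x 0 i| <= `|x|.
Proof.
by rewrite [`|x|]mx_normrE; apply: (le_bigmax _ (fun ij => `|x ij.1 ij.2|) (0, i)).
Qed.

Lemma normr_rV_le m (x : 'rV[R]_m) c : 0 <= c -> (forall i, `|x 0 i| <= c) -> `|x| <= c.
Proof.
by move=> c0 H; rewrite [`|x|]mx_normrE; apply: bigmax_le => // -[i j] _; rewrite ord1.
Qed.

Lemma normr_mulmx_bound m k (Q : 'M[R]_(m, k)) :
  exists2 K : R, 0 <= K & forall x : 'rV[R]_m, `|x *m Q| <= K * `|x|.
Proof.
pose K := \sum_i \sum_j `|Q i j|.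
have K0 : 0 <= K by apply: sumr_ge0 => i _; exact: sumr_ge0.
exists K => // x; apply: normr_rV_le; first by rewrite mulr_ge0.
move=> j; rewrite mxE; apply: le_trans (ler_norm_sum _ _ _) _.
rewrite /K mulr_suml; apply: ler_sum => i _; rewrite normrM mulrC.
apply: ler_pM => //; last exact: normr_coord.
by rewrite (bigD1 j)//= lerDl; exact: sumr_ge0.
Qed.

Lemma enorm_ge0 m (x : 'rV[R]_m) : 0 <= enorm x.
Proof. exact: sqrtr_ge0. Qed.

Lemma sumr_sqr_ge0 m (x : 'rV[R]_m) : 0 <= \sum_i x 0 i ^+ 2.
Proof. by apply: sumr_ge0 => i _; exact: sqr_ge0. Qed.

Lemma normr_le_enorm m (x : 'rV[R]_m) : `|x| <= enorm x.
Proof.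
apply: normr_rV_le; first exact: enorm_ge0.
move=> i; rewrite -sqrtr_sqr ler_sqrt ?sumr_sqr_ge0//.
by rewrite (bigD1 i)//= lerDl; apply: sumr_ge0 => j _; exact: sqr_ge0.
Qed.

(** The constant is crude; only the equivalence of the two norms matters. *)
Lemma enorm_le_normr m (x : 'rV[R]_m) : enorm x <= m.+1%:R * `|x|.
Proof.
have m0 : 0 <= m.+1%:R * `|x| by rewrite mulr_ge0.
rewrite -(ger0_norm m0) -sqrtr_sqr ler_sqrt ?sqr_ge0//.
apply: (@le_trans _ _ (\sum_(i < m) `|x| ^+ 2)).
  by apply: ler_sum => i _; rewrite -ler_sqrt ?sqr_ge0// !sqrtr_sqr normr_id normr_coord.
rewrite sumr_const card_ord exprMn -[_ *+ m]mulr_natl ler_wpM2r ?sqr_ge0//.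
by rewrite -natrX ler_nat; lia.
Qed.

Lemma first_coordsD x y : first_coords (x + y) = first_coords x + first_coords y.
Proof. by apply/rowP => i; rewrite !mxE. Qed.

Lemma first_coordsZ (t : R) x : first_coords (t *: x) = t *: first_coords x.
Proof. by apply/rowP => i; rewrite !mxE. Qed.

Lemma normr_first_coords x : `|first_coords x| <= `|x|.
Proof. by apply: normr_rV_le => // i; rewrite mxE normr_coord. Qed.

(** Inverse of the splitting of a point into [first_coords] and its last coordinate. *)
Definition graph_point a (s : R) : V := \row_i oapp (a 0) s (unlift ord_max i).

Lemma first_coords_graph_point a s : first_coords (graph_point a s) = a.
Proof.
apply/rowP => i; rewrite !mxE.
have -> : widen_ord (leqnSn n) i = lift ord_max i.
  by apply: val_inj; rewrite [RHS]lift_max.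
by rewrite liftK.
Qed.

Lemma graph_point_max a s : graph_point a s 0 ord_max = s.
Proof. by rewrite mxE unlift_none. Qed.

Lemma first_coords_inj x y : first_coords x = first_coords y ->
  x 0 ord_max = y 0 ord_max -> x = y.
Proof.
move=> /rowP xy xy'; apply/rowP => i; case: (unliftP ord_max i) => [j ->|-> //].
have := xy j; rewrite !mxE.
have -> // : widen_ord (leqnSn n) j = lift ord_max j.
by apply: val_inj; rewrite [RHS]lift_max.
Qed.

(** Take [q] straight above [y] in the rotated coordinates. Moving from [w] towards [q'] raises the
    last coordinate at a rate close to [s], while the graph below changes only at a rate of order
    [e]. *)
Lemma lipschitz_graph_star_near A y :
  lipschitz_graph_near A y -> exists q, star_near A y q.
Proof.
move=> [Q [g [L [QQ gL nA]]]].
have /nbhs_normP[r /= r0 Hr] := nA.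
have {}Hr x : `|x - y| < r -> A x <-> g (first_coords (x *m Q)) < (x *m Q) 0 ord_max.
  by rewrite distrC; exact: Hr.
have [K K0 HK] := normr_mulmx_bound _ _ Q.
pose v : V := delta_mx 0 ord_max *m Q^T.
have vQ : v *m Q = delta_mx 0 ord_max by rewrite -mulmxA (mulmx1C QQ) mulmx1.
have v0 := normr_ge0 v.
(* [e * M] bounds all errors of the final estimate, and [e] is chosen with [e * (1 + M) <= s]. The
   sign of [L] is not given, hence the absolute value. *)
pose M := 2 * K * (1 + `|L| * n.+1%:R).
have LM : 0 <= `|L| * n.+1%:R by rewrite mulr_ge0.
have M0 : 0 <= M by rewrite !mulr_ge0//; lra.
pose s := r / (2 * (1 + `|v|)).
have s0 : 0 < s by rewrite divr_gt0// mulr_gt0//; lra.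
have sv : s * `|v| <= r / 2.
  have : s * (1 + `|v|) = r / 2 by rewrite /s; field; rewrite gt_eqF//; lra.
  by lra.
pose e := Num.min (r / 4) (s / (1 + M)).
have e0 : 0 < e by rewrite lt_min !divr_gt0//; lra.
have er : e <= r / 4 by rewrite ge_min lexx.
have eM : e * (1 + M) <= s by rewrite -ler_pdivlMr ?ge_min ?lexx ?orbT//; lra.
exists (y + s *: v); exists e => // w q' t we qe Aw /andP[t0 t1].
pose x := (q' - (y + s *: v)) - (w - y).
have x2 : `|x| < 2 * e by apply: le_lt_trans (ler_normB _ _) _; lra.
have qwE : q' - w = s *: v + x by apply/rowP => i; rewrite !mxE; ring.
have Aw' : g (first_coords (w *m Q)) < (w *m Q) 0 ord_max.
  by apply/Hr => //; lra.
apply/Hr.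
  have -> : w + t *: (q' - w) - y = (1 - t) *: (w - y) + t *: (s *: v + (q' - (y + s *: v))).
    by apply/rowP => i; rewrite !mxE; ring.
  apply: le_lt_trans (ler_normD _ _) _; rewrite !normrZ (ger0_norm t0).
  rewrite ger0_norm ?subr_ge0//.
  have : `|s *: v + (q' - (y + s *: v))| <= 3 / 4 * r.
    by apply: le_trans (ler_normD _ _) _; rewrite normrZ (gtr0_norm s0); lra.
  move=> /(ler_wpM2l t0) h1.
  have : (1 - t) * `|w - y| <= (1 - t) * (3 / 4 * r).
    by rewrite ler_wpM2l ?subr_ge0//; lra.
  by lra.
rewrite qwE mulmxDl -scalemxAl mulmxDl -scalemxAl vQ.
set z := x *m Q.
have zK : `|z| <= K * (2 * e).
  by apply: le_trans (HK x) _; rewrite ler_wpM2l// ltW.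
have zl : `|z 0 ord_max| <= K * (2 * e) by apply: le_trans (normr_coord _ _ _) _.
have zf : enorm (first_coords z) <= n.+1%:R * (K * (2 * e)).
  apply: le_trans (enorm_le_normr _ _) _; rewrite ler_wpM2l//.
  exact: le_trans (normr_first_coords _) zK.
rewrite first_coordsD first_coordsZ.
have -> : first_coords (s *: delta_mx 0 ord_max + z) = first_coords z.
  rewrite first_coordsD first_coordsZ; apply/rowP => i; rewrite !mxE.
  by rewrite eqxx/= -val_eqE/= ltn_eqF// mulr0 add0r.
have -> : (w *m Q + t *: (s *: delta_mx 0 ord_max + z)) 0 ord_max =
    (w *m Q) 0 ord_max + t * (s + z 0 ord_max).
  rewrite mxE; congr (_ + _); rewrite mxE; congr (_ * _); rewrite mxE; congr (_ + _).
  by rewrite !mxE !eqxx mulr1.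
have := gL (first_coords (w *m Q) + t *: first_coords z) (first_coords (w *m Q)).
rewrite [_ + _ - _]addrC addKr.
have -> : enorm (t *: first_coords z) = t * enorm (first_coords z).
  rewrite /enorm -[t in RHS]ger0_norm// -sqrtr_sqr -sqrtrM ?sqr_ge0// mulr_sumr.
  by congr Num.sqrt; apply: eq_bigr => i _; rewrite !mxE exprMn.
move=> gb.
have : L * (t * enorm (first_coords z)) <= t * (`|L| * n.+1%:R * (2 * K * e)).
  rewrite mulrCA ler_wpM2l//.
  apply: le_trans (ler_wpM2r (enorm_ge0 _ _) (ler_norm L)) _.
  by rewrite -mulrA ler_wpM2l//; apply: le_trans zf _; rewrite ler_wpM2l//; lra.
move: gb; rewrite ler_norml => /andP[_ gb] gb'.
have zl' : - (K * (2 * e)) <= z 0 ord_max by move: zl; rewrite ler_norml => /andP[].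
have eM' : t * (K * (2 * e) + `|L| * n.+1%:R * (2 * K * e)) <= t * s.
  by rewrite ler_wpM2l//; move: eM; rewrite /M; nra.
by have : t * (- (K * (2 * e))) <= t * z 0 ord_max by [rewrite ler_wpM2l]; lra.
Qed.

End lipschitz_graph.

(** * From local star-shapedness back to Lipschitz graphs *)

Section star_near_graph.
Context {R : realType} {n : nat}.
Notation V := 'rV[R]_n.+1.
Implicit Types (A : set V) (p q v w x y d : V) (a b : 'rV[R]_n).

Lemma enorm0 m : enorm (0 : 'rV[R]_m) = 0.
Proof. by rewrite /enorm big1 ?sqrtr0// => i _; rewrite mxE expr0n. Qed.

Lemma enorm_eq0 m (x : 'rV[R]_m) : enorm x = 0 -> x = 0.
Proof.
move=> x0; apply/eqP; rewrite -normr_eq0 eq_le normr_ge0 andbT -x0.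
exact: normr_le_enorm.
Qed.

Lemma enormC m (x y : 'rV[R]_m) : enorm (x - y) = enorm (y - x).
Proof.
rewrite /enorm; congr Num.sqrt; apply: eq_bigr => i _.
by rewrite !mxE -sqrrN opprB.
Qed.

(* The Householder reflection exchanging the last basis vector and the
   normalization of [v]. *)
Lemma orthogonal_completion v : v != 0 ->
  exists2 Q : 'M[R]_n.+1, Q *m Q^T = 1%:M &
    delta_mx 0 ord_max *m Q^T = (enorm v)^-1 *: v.
Proof.
move=> v0; pose c := enorm v.
have c0 : 0 < c.
  rewrite lt_neqAle enorm_ge0 andbT eq_sym; apply/eqP => /enorm_eq0/eqP.
  by rewrite (negbTE v0).
pose d : V := delta_mx 0 ord_max; pose e := c^-1 *: v.
pose dot x y := \sum_i x 0 i * y 0 i.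
have dotE x y : x *m y^T = (dot x y)%:M.
  by apply/matrixP => i j; rewrite !ord1 !mxE eqxx mulr1n; apply: eq_bigr => k _; rewrite !mxE.
have dd : dot d d = 1.
  rewrite /dot (bigD1 ord_max)//= big1 ?addr0; first by rewrite !mxE !eqxx mulr1.
  by move=> i /negbTE im; rewrite !mxE im mul0r.
have ee : dot e e = 1.
  have cc : c ^+ 2 = \sum_i v 0 i ^+ 2 by rewrite sqr_sqrtr ?sumr_sqr_ge0.
  have -> : dot e e = c ^- 2 * c ^+ 2.
    by rewrite [X in _ * X]cc mulr_sumr; apply: eq_bigr => i _; rewrite !mxE; field; rewrite gt_eqF.
  by rewrite mulVf// expf_neq0// gt_eqF.
rewrite -/c -/e.
(* If the two vectors agree there is no axis to reflect along, and the identity serves. *)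
have [<-|de] := eqVneq d e.
  by exists 1%:M; rewrite trmx1 mulmx1.
have [u uE] : exists u, u = e - d by exists (e - d).
pose s := dot u u.
have sE : s = 2 - 2 * dot d e.
  have -> : 2 - 2 * dot d e = dot e e + dot d d - 2 * dot d e by rewrite ee dd; ring.
  rewrite /s uE /dot mulr_sumr -big_split -sumrB/=.
  by apply: eq_bigr => i _; rewrite !mxE; ring.
have s0 : s != 0.
  apply/eqP => us; move: de; rewrite eq_sym -subr_eq0 => /eqP; apply.
  rewrite -uE; apply: enorm_eq0; rewrite -[RHS]sqrtr0 -us; congr Num.sqrt.
pose k := 2 / s.
pose Q := 1%:M - k *: (u^T *m u).
have QT : Q^T = Q by rewrite /Q linearB/= linearZ/= trmx1 trmx_mul trmxK.
exists Q; rewrite QT.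
  have uu : (u^T *m u) *m (u^T *m u) = s *: (u^T *m u).
    by rewrite mulmxA -(mulmxA u^T) dotE mul_mx_scalar -scalemxAl.
  rewrite /Q mulmxBl mul1mx mulmxBr mulmx1 -scalemxAl -scalemxAr uu !scalerA.
  apply/matrixP => i j; rewrite !mxE /k; field.
  exact: s0.
rewrite /Q mulmxBr mulmx1 -scalemxAr mulmxA dotE mul_scalar_mx scalerA.
have -> : dot (delta_mx 0 ord_max) u = dot d e - 1.
  rewrite -dd /dot -sumrB; apply: eq_bigr => i _; rewrite uE !mxE; ring.
have -> : k * (dot d e - 1) = -1 by rewrite /k; move: s0; rewrite sE => ?; field.
by rewrite scaleN1r opprK uE addrC subrK.
Qed.

(** [A] is controlled only near [p], but the graph function is defined everywhere. So [A] is
    replaced by the union [C] of rays from points of [A] near [p] in directions near [v]. It agrees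
    with [A] near [p] and is stable under a cone of translations, which makes the infimum of its
    heights over a point a Lipschitz function. *)
Lemma star_near_lipschitz_graph A p q : open A -> boundary A p ->
  star_near A p q -> lipschitz_graph_near A p.
Proof.
move=> oA [cA niA] [e e0 He].
have nA : ~ A p by move=> Ap; apply: niA; rewrite (interior_id A).1.
have [v vE] : exists v, v = q - p by exists (q - p).
have v0 : v != 0.
  rewrite vE subr_eq0; apply/eqP => qp; apply: nA.
  have /closure_ballP/(_ _ e0)[w Aw wp] := cA.
  have := He w p 1 wp; rewrite qp subrr normr0 => /(_ e0 Aw).
  by rewrite scale1r subrKC; apply; rewrite ler01 lexx.
have [Q QQ Qv] := orthogonal_completion v v0.
have Q'Q := mulmx1C QQ.
pose c := enorm v; rewrite -/c in Qv.
have c0 : 0 < c by apply: lt_le_trans (normr_le_enorm _ _); rewrite normr_gt0.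
have vQ : v *m Q = c *: delta_mx 0 ord_max.
  have -> : v = c *: (delta_mx 0 ord_max *m Q^T).
    by rewrite Qv scalerA mulfV ?gt_eqF// scale1r.
  by rewrite -scalemxAl -mulmxA Q'Q mulmx1.
have [K K0 HK] := normr_mulmx_bound _ _ Q.
have [K' K'0 HK'] := normr_mulmx_bound _ _ Q^T.
have nv0 : 0 < `|v| by rewrite normr_gt0.
(* In this order, the bounds keep [w + d] within [e] of [q], force [t <= 1] on rays that end within
   [r] of [p], and prevent directions from pointing downwards. *)
pose r := Num.min (e / 2) (Num.min (`|v| / 4) (c / (1 + K))).
have r0 : 0 < r by rewrite !lt_min !divr_gt0//; lra.
have re : r <= e / 2 by rewrite ge_min lexx.
have rv : r <= `|v| / 4 by rewrite !ge_min lexx orbT.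
have rK : r * (1 + K) <= c by rewrite -ler_pdivlMr ?ge_min ?lexx ?orbT//; lra.
pose C := [set x | exists w t d, [/\ A w, `|w - p| < r, 0 <= t, `|d - v| < r & x = w + t *: d]].
(* Directions near [v] form a convex set, so two successive steps combine into one. *)
have CK x t d : C x -> 0 <= t -> `|d - v| < r -> C (x + t *: d).
  move=> [w [s [f [Aw wp s0 fv ->]]]] t0 dv; exists w.
  have [st|st] := eqVneq (s + t) 0.
    have [-> ->] : s = 0 /\ t = 0 by split; lra.
    by exists 0, f; split=> //; rewrite !scale0r !addr0.
  have st0 : 0 < s + t by rewrite lt_neqAle eq_sym st addr_ge0.
  exists (s + t), ((s + t)^-1 *: (s *: f + t *: d)); split=> //; first exact: ltW.
    have -> : (s + t)^-1 *: (s *: f + t *: d) - v =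
      (s + t)^-1 *: (s *: (f - v) + t *: (d - v)).
      by apply/rowP => i; rewrite !mxE; field.
    rewrite normrZ gtr0_norm ?invr_gt0// ltr_pdivrMl//.
    apply: le_lt_trans (ler_normD _ _) _; rewrite !normrZ (ger0_norm s0) (ger0_norm t0).
    by case: (ltrP 0 t) => ?; nra.
  by rewrite scalerA mulfV// scale1r addrA.
have AC x : A x -> `|x - p| < r -> C x.
  by move=> Ax xp; exists x, 0, v; split; rewrite ?subrr ?normr0 ?scale0r ?addr0.
have CA x : C x -> `|x - p| < r -> A x.
  move=> [w [t [d [Aw wp t0 dv xE]]]] xp.
  have t1 : t <= 1.
    rewrite leNgt; apply/negP => t1.
    have : t * `|d| < 2 * r.
      rewrite -(ger0_norm t0) -normrZ.
      have -> : t *: d = (x - p) - (w - p) by rewrite xE; apply/rowP => i; rewrite !mxE; ring.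
      by apply: le_lt_trans (ler_normB _ _) _; lra.
    have : `|v| <= `|d| + `|d - v| by have := ler_distD d v 0; rewrite !subr0 (distrC v d); lra.
    by nra.
  have -> : x = w + t *: ((w + d) - w) by rewrite xE [w + d]addrC addrK.
  apply: He => //; [lra| |by rewrite t0].
  have -> : w + d - q = (d - v) + (w - p) by rewrite vE; apply/rowP => i; rewrite !mxE /=; ring.
  by apply: le_lt_trans (ler_normD _ _) _; lra.
have height x : C x -> (p *m Q) 0 ord_max - K * r <= (x *m Q) 0 ord_max.
  move=> [w [t [d [Aw wp t0 dv ->]]]].
  have hb (z : V) : `|z| < r -> - (K * r) <= (z *m Q) 0 ord_max.
    move=> zr; have : `|(z *m Q) 0 ord_max| <= K * r.
      apply: le_trans (normr_coord _ _ _) _; apply: le_trans (HK z) _.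
      by rewrite ler_wpM2l// ltW.
    by rewrite ler_norml => /andP[].
  have -> : w + t *: d = p + (w - p) + t *: ((d - v) + v).
    by apply/rowP => i; rewrite !mxE; ring.
  have -> : (p + (w - p) + t *: ((d - v) + v)) *m Q =
      p *m Q + (w - p) *m Q + t *: ((d - v) *m Q + c *: delta_mx 0 ord_max).
    by rewrite -vQ -!mulmxDl scalemxAl -mulmxDl.
  have -> (x1 x2 x3 x4 : V) : (x1 + x2 + t *: (x3 + x4)) 0 ord_max =
     x1 0 ord_max + x2 0 ord_max + t * (x3 0 ord_max + x4 0 ord_max) by rewrite !mxE.
  have -> : (c *: delta_mx 0 ord_max : V) 0 ord_max = c by rewrite !mxE !eqxx mulr1.
  have h1 := hb _ wp; have h2 := hb _ dv.
  have : 0 <= t * (((d - v) *m Q) 0 ord_max + c) by rewrite mulr_ge0//; lra.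
  by lra.
(* With this slope every displacement satisfying [L * enorm a <= s] is a nonnegative multiple of a
   direction within [r] of [v]; the summand [1] makes that bound strict. *)
pose L := c * (1 + K') / r.
have L0 : 0 < L by rewrite divr_gt0// mulr_gt0//; lra.
have Lr : L * r = c * (1 + K') by rewrite /L; field; rewrite gt_eqF.
have Cup x a s : C x -> L * enorm a <= s -> C (x + graph_point a s *m Q^T).
  move=> Cx Ls; have a0 := enorm_ge0 _ a.
  have [s0|s0] := eqVneq s 0.
    have -> : a = 0 by apply: enorm_eq0; apply/eqP; rewrite eq_le a0 andbT; nra.
    suff -> : graph_point (0 : 'rV[R]_n) s = 0 by rewrite mul0mx addr0.
    apply: first_coords_inj.
      by rewrite first_coords_graph_point; apply/rowP => i; rewrite !mxE.
    by rewrite graph_point_max mxE s0.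
  have {}s0 : 0 < s by rewrite lt_neqAle eq_sym s0/=; nra.
  have -> : graph_point a s *m Q^T = (s / c) *: (v + (c / s) *: (graph_point a 0 *m Q^T)).
    have -> : graph_point a s = graph_point a 0 + s *: delta_mx 0 ord_max.
      apply: first_coords_inj.
        rewrite first_coordsD first_coordsZ !first_coords_graph_point.
        apply/rowP => i; rewrite !mxE eqxx/= -val_eqE/=.
        by rewrite ltn_eqF// mulr0 addr0.
      by rewrite [RHS]mxE !graph_point_max !mxE !eqxx mulr1 add0r.
    rewrite mulmxDl -scalemxAl Qv scalerDr !scalerA addrC.
    have -> : s * c^-1 * (c * s^-1) = 1 by field; rewrite !gt_eqF.
    by rewrite scale1r.
  apply: CK => //; first by rewrite divr_ge0 ?ltW.
  rewrite [v + _]addrC addrK normrZ ger0_norm ?divr_ge0 ?ltW//.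
  rewrite mulrAC ltr_pdivrMr//.
  have : `|graph_point a 0 *m Q^T| <= K' * enorm a.
    apply: le_trans (HK' _) _; rewrite ler_wpM2l//.
    apply: normr_rV_le => // i; rewrite mxE; case: unliftP => [j _|_]/=; last by rewrite normr0.
    by apply: le_trans (normr_le_enorm _ _); exact: normr_coord.
  move=> gK; have h1 : c * `|graph_point a 0 *m Q^T| <= c * (K' * enorm a).
    by rewrite ler_wpM2l// ltW.
  have h2 : L * enorm a * r <= s * r by rewrite ler_wpM2r// ltW.
  have h3 : L * enorm a * r = c * (K' * enorm a) + c * enorm a by rewrite mulrAC Lr; ring.
  have [E0|E0] := eqVneq (enorm a) 0; first by rewrite E0 !mulr0 in h1; nra.
  have : 0 < c * enorm a by rewrite mulr_gt0// lt_neqAle eq_sym E0.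
  lra.
pose S a := [set s | exists2 y, C y & first_coords (y *m Q) = a /\ (y *m Q) 0 ord_max = s].
have Sup a b s s' : S a s -> s + L * enorm (b - a) <= s' -> S b s'.
  move=> [y Cy [ya ys]] ss'; exists (y + graph_point (b - a) (s' - s) *m Q^T).
    by apply: Cup => //; lra.
  rewrite mulmxDl -mulmxA Q'Q mulmx1 first_coordsD first_coords_graph_point ya subrKC.
  by split=> //; rewrite mxE ys graph_point_max subrKC.
have Slb a : lbound (S a) ((p *m Q) 0 ord_max - K * r).
  by move=> s [y Cy [_ <-]]; exact: height.
have S0 a : S a !=set0.
  have /closure_ballP/(_ _ r0)[w Aw wp] := cA.
  pose a0 := first_coords (w *m Q).
  exists ((w *m Q) 0 ord_max + L * enorm (a - a0)).
  by apply: (Sup a0 _ ((w *m Q) 0 ord_max)) => //; exists w => //; exact: AC.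
have iS a : has_inf (S a) by split=> //; exists ((p *m Q) 0 ord_max - K * r).
pose g a := inf (S a).
have gle a b : g b <= g a + L * enorm (b - a).
  rewrite -lerBlDr; apply: lb_le_inf => // s Ss.
  by rewrite lerBlDr; apply: ge_inf; [exact: (iS b).2|exact: Sup Ss _].
exists Q, g, L; split=> //.
  move=> a b; rewrite ler_norml; have := gle a b; have := gle b a.
  by rewrite (enormC _ b a); lra.
apply/nbhs_normP; exists r => //= x /=; rewrite distrC => xp; split=> [Ax|].
  (* A small step down along [v] stays in [A], so the height of [x] strictly exceeds the infimum. *)
  have [f f0 Hf] := open_ballP _ _ oA Ax.
  pose h := Num.min (f / 2) ((r - `|x - p|) / 2).
  have h0 : 0 < h by rewrite lt_min !divr_gt0// subr_gt0.
  have [hf hr] : h <= f / 2 /\ h <= (r - `|x - p|) / 2 by rewrite !ge_min !lexx orbT.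
  pose t := h / `|v|.
  have t0 : 0 < t by rewrite divr_gt0.
  have tv : `|t *: v| = h by rewrite normrZ gtr0_norm// /t divfK// gt_eqF.
  have : S (first_coords (x *m Q)) ((x *m Q) 0 ord_max - t * c).
    exists (x - t *: v).
      apply: AC; first by apply: Hf; rewrite addrC addKr normrN tv; lra.
      rewrite addrAC; apply: le_lt_trans (ler_normB _ _) _; rewrite tv; lra.
    rewrite mulmxBl -scalemxAl vQ scalerA; split.
      apply/rowP => i; rewrite !mxE eqxx/= -val_eqE/=.
      by rewrite ltn_eqF// mulr0 subr0.
    by rewrite [LHS]mxE; congr (_ + _); rewrite !mxE !eqxx mulr1.
  move=> /(ge_inf (iS _).2); rewrite -/(g _) => gx.
  by apply: le_lt_trans gx _; rewrite ltrBlDr ltrDl mulr_gt0.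
(* Some point of [C] lies vertically below [x]; going straight up from it stays in [C] and reaches
   [x]. *)
move=> /(inf_lt (S0 _))[s Ss sx]; apply: CA => //.
have [|y Cy [ya ys]] := Sup _ (first_coords (x *m Q)) _ ((x *m Q) 0 ord_max) Ss.
  by rewrite subrr enorm0 mulr0 addr0 ltW.
have <- : y = x; last by [].
have yx := first_coords_inj _ _ ya ys.
by rewrite -[y]mulmx1 -[x]mulmx1 -QQ !mulmxA yx.
Qed.

End star_near_graph.

Section lipschitz_star.
Context {R : realType} {n : nat}.
Implicit Types A : set 'rV[R]_n.+1.

Lemma lipschitz_star_domain A : lipschitz_domain A -> star_domain A.
Proof.
move=> [oA cA _ lA]; split=> // p.
have [Ap|nAp] := pselect (A p); first by exists p; exact: star_near_interior.
have [cp|ncp] := pselect (closure A p); last by exists p; exact: star_near_outside.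
apply/lipschitz_graph_star_near/lA; split=> // /interior_subset.
exact: nAp.
Qed.

Lemma star_lipschitz_domain A : star_domain A -> A !=set0 -> lipschitz_domain A.
Proof.
move=> [oA cA sA] A0; split=> // p bp; have [q sq] := sA p.
exact: star_near_lipschitz_graph sq.
Qed.

End lipschitz_star.

(** * Null sets of the Hausdorff measure *)

Section countable_base.
Context {R : realType} {n : nat}.

(** A countable base of the topology; indices that encode no pair of centre and radius give the
    empty set. *)
Definition rational_ball (k : nat) : set 'rV[R]_n.+1 :=
  if unpickle k is Some (c, m) then
    [set w | `|w - map_mx (ratr : rat -> R) (c : 'rV[rat]_n.+1)| < (m : nat).+1%:R^-1]
  else set0.

Lemma rational_ball_open k : open (rational_ball k).
Proof.
by rewrite /rational_ball; case: unpickle => [[c m]|]; [exact: norm_ball_open|exact: open0].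
Qed.

Lemma rational_ball_base (W : set 'rV[R]_n.+1) x : open W -> W x ->
  exists2 k, rational_ball k x & rational_ball k `<=` W.
Proof.
move=> oW Wx; have [e e0 He] := open_ballP _ _ oW Wx.
have e2 : 0 < e / 2 by rewrite divr_gt0.
pose m := Num.truncn (e / 2)^-1; pose r : R := m.+1%:R^-1.
have re : r < e / 2 by rewrite invf_plt ?posrE//; exact: truncnS_gt.
have r0 : 0 < r by rewrite invr_gt0.
have [f Hf] : {f : 'I_n.+1 -> rat & forall i, `|x 0 i - ratr (f i)| < r / 2}.
  apply: (@choice _ _ (fun i (c : rat) => `|x 0 i - ratr c| < r / 2)) => i.
  have /rat_in_itvoo[c] : x 0 i - r / 2 < x 0 i + r / 2 by lra.
  by rewrite in_itv/= => ?; exists c; rewrite ltr_norml; lra.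
pose c : 'rV[R]_n.+1 := map_mx ratr (\row_i f i).
have xc : `|x - c| <= r / 2.
  by apply: normr_rV_le; [lra|move=> i; rewrite !mxE ltW].
have bE : rational_ball (pickle (\row_i f i : 'rV[rat]_n.+1, m)) = [set w | `|w - c| < r].
  by rewrite /rational_ball pickleK.
exists (pickle (\row_i f i : 'rV[rat]_n.+1, m)); rewrite bE /=; first by lra.
by move=> w /= wc; apply: He; have := ler_distD c w x; rewrite (distrC c x); lra.
Qed.

End countable_base.

Section hausdorff_null.
Context {R : realType} {n : nat}.
Implicit Types A B : set 'rV[R]_n.
Local Open Scope ereal_scope.

Lemma hausdorff_gauge_ge0 s A : 0 <= hausdorff_gauge s A.
Proof.
rewrite /hausdorff_gauge; case: ifPn => // /set0P[x Ax].
apply: expe_ge0; apply: ereal_sup_ubound; exists (x, x) => //=.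
by rewrite subrr enorm0.
Qed.

Lemma le_hausdorff_measure s A B : A `<=` B ->
  hausdorff_measure s A <= hausdorff_measure s B.
Proof.
move=> AB; apply: ge_ereal_sup => _ [d d0 <-].
apply: (@le_trans _ _ (hausdorff_pre s d B)); last first.
  by apply: ereal_sup_ubound; exists d.
apply: ereal_inf_le_tmp => _ [F [BF Fd] <-]; exists F => //; split=> //.
exact: subset_trans BF.
Qed.

Lemma hausdorff_measure_set0_le0 s : hausdorff_measure s (set0 : set 'rV[R]_n) <= 0.
Proof.
apply: ge_ereal_sup => _ [d d0 <-]; apply: ereal_inf_lbound.
exists (fun=> set0).
  split=> // k; rewrite /ediam (_ : [set _ | _ in _] = set0) ?ereal_sup0 ?leNye//.
  by apply/seteqP; split=> // x [[a b] [[]]].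
by apply: eseries0 => k _ _; rewrite /hausdorff_gauge eqxx.
Qed.

(** Being null is written [<= 0], as the measure is never negative. Each [A k] is covered at cost at
    most [e / 2 ^ k.+1], and a bijection enumerates the double sequence of covering sets. *)
Lemma hausdorff_measure_bigcup_le0 s (A : nat -> set 'rV[R]_n) :
  (forall k, hausdorff_measure s (A k) <= 0) ->
  hausdorff_measure s (\bigcup_k A k) <= 0.
Proof.
move=> A0; apply: ge_ereal_sup => _ [d d0 <-].
apply/lee_addgt0Pr => e e0; rewrite add0e.
pose P k (F : nat -> set 'rV[R]_n) := [/\ A k `<=` \bigcup_j F j,
  forall j, ediam (F j) <= d%:E &
  \sum_(j <oo) hausdorff_gauge s (F j) <= (e / (2 ^ k.+1)%:R)%:E].
have [F PF] : {F : nat -> nat -> set 'rV[R]_n & forall k, P k (F k)}.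
  apply: (@choice _ _ P) => k.
  have : hausdorff_pre s d (A k) < (e / (2 ^ k.+1)%:R)%:E.
    apply: (@le_lt_trans _ _ 0); last by rewrite lte_fin divr_gt0.
    by apply: le_trans (A0 k); apply: ereal_sup_ubound; exists d.
  by move=> /ereal_inf_lt[_ [G [AG Gd] <-] /ltW Ge]; exists G.
have /card_esym/ppcard_eqP[f] := card_nat2.
have g0 p : 0 <= hausdorff_gauge s (F p.1 p.2) by exact: hausdorff_gauge_ge0.
apply: (@le_trans _ _ (\sum_(j <oo) hausdorff_gauge s (F (f j).1 (f j).2))).
  apply: ereal_inf_lbound; exists (fun j => F (f j).1 (f j).2) => //; split.
    move=> x [k _ Akx]; have [+ _ _] := PF k; move=> /(_ x Akx)[j _ Fx].
    by exists (f^-1%FUN (k, j)) => //=; rewrite invK ?inE.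
  by move=> j; have [] := PF (f j).1.
have -> : \sum_(j <oo) hausdorff_gauge s (F (f j).1 (f j).2) =
    \sum_(k <oo) \sum_(j <oo) hausdorff_gauge s (F k j).
  rewrite nneseries_esumT//.
  rewrite -(reindex_esum _ [set: nat * nat] f (fun p => hausdorff_gauge s (F p.1 p.2)));
    last exact: bij.
  rewrite nneseries_esumT; last by move=> k; apply: nneseries_ge0 => *; exact: hausdorff_gauge_ge0.
  have -> : [set: nat * nat] = [set: nat] `*`` (fun=> [set: nat]) by apply/seteqP.
  rewrite -(@esum_esum R nat nat _ _ (fun k j => hausdorff_gauge s (F k j))); last first.
    by move=> *; exact: hausdorff_gauge_ge0.
  apply: eq_esum => k _.
  by rewrite nneseries_esumT // => j; exact: hausdorff_gauge_ge0.
apply: le_trans (epsilon_trick0 xpredT (ltW e0)).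
apply: lee_nneseries => [k _ _|k _]; first by apply: nneseries_ge0 => *; exact: hausdorff_gauge_ge0.
by have [] := PF k.
Qed.

End hausdorff_null.

(** Otherwise countably many basic balls, each meeting [A] in a null set, would cover [A]. *)
Lemma hausdorff_support (R : realType) n s (A : set 'rV[R]_n.+1) :
  (0 < hausdorff_measure s A)%E ->
  exists2 z, A z & forall W, open W -> W z -> (0 < hausdorff_measure s (W `&` A))%E.
Proof.
move=> A0; apply: contrapT => nz.
pose B k := if (hausdorff_measure s (rational_ball k `&` A) <= 0)%E
  then rational_ball k `&` A else set0.
have B0 k : (hausdorff_measure s (B k) <= 0)%E.
  by rewrite /B; case: ifPn => // _; exact: hausdorff_measure_set0_le0.
suff AB : A `<=` \bigcup_k B k.
  have := le_trans (le_hausdorff_measure s _ _ AB) (hausdorff_measure_bigcup_le0 s B B0).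
  by rewrite leNgt A0.
move=> z Az; have [W [oW Wz WA]] : exists W, [/\ open W, W z &
    (hausdorff_measure s (W `&` A) <= 0)%E].
  apply: contrapT => nW; apply: nz; exists z => // W oW Wz.
  by rewrite ltNge; apply/negP => WA; apply: nW; exists W.
have [k kz kW] := rational_ball_base _ _ oW Wz.
exists k => //; rewrite /B ifT//.
by apply: le_trans WA; apply: le_hausdorff_measure => w [/kW].
Qed.

(** * Growing a domain along a path *)

Section reachable.
Context {R : realType} {n : nat}.
Notation V := 'rV[R]_n.+1.
Context (Omega O U0 : set V) (sOmega : star_domain Omega) (oO : open O).

(** The last clause lets the closure meet the boundary of [Omega] only in [closure U0]; this later
    keeps a boundary point [x] off [closure U]. *)
Definition grown_domain U :=
  [/\ star_domain U, U0 `<=` U, U `<=` Omega &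
      closure U `<=` closure U0 `|` (Omega `&` O)].

Definition reachable b := (Omega `&` O) b /\ exists2 U, grown_domain U & U b.

Let open_regular_part : open (Omega `&` O).
Proof. by apply: openI => //; case: sOmega. Qed.

Lemma reachable_segment a b :
  (forall t, 0 <= t <= 1 -> (Omega `&` O) (a + t *: (b - a))) ->
  reachable b -> reachable a.
Proof.
move=> abM [Mb [U [sU U0U UO cU] Ub]].
have Ma : (Omega `&` O) a by have := abM 0; rewrite scale0r addr0; apply; lra.
split=> //.
have [d d0 dM] := tube_subset_open _ _ _ open_regular_part abM.
have [|||U' [W [sU' UU' U'O cU' [oW Wa WU']]]] :=
  star_domain_attach Omega (Omega `&` O) U a b _ sU UO Ub open_regular_part abM.
- by case: sOmega.
- by move=> t t01 _; have [] := abM t t01.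
(* A whole convex tube around the segment lies in [Omega], so segments between its points stay in
   [Omega]. *)
- move=> t /andP[t0 t1] _; exists d => // p [u /andP[u0 u1] pd].
  have T y r : 0 <= r <= 1 -> `|y - (a + r *: (b - a))| < d -> tube a b d y by exists r.
  have tubeO y : tube a b d y -> Omega y by move=> /dM[].
  have Tp : tube a b d p.
    apply: (T _ (u * t)); first by apply/andP; split; nra.
    by move: pd; congr (`|_ - _| < _); apply/rowP => i; rewrite !mxE; ring.
  have Ty : tube a b d (a + t *: (b - a)) by apply: tube_segment => //; rewrite t0.
  have [e e0 He] := convex_star_near _ p _ (tube_open a b d) (tube_convex a b d) Ty.
  have [f f0 Hf] := open_ballP _ _ (tube_open a b d) Tp.
  exists (Num.min e f); first by rewrite lt_min e0.
  move=> w q' s; rewrite !lt_min => /andP[we wf] /andP[qe _] _ s01.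
  by apply: tubeO; apply: He => //; exact: Hf.
exists U'; last by apply: WU'; case: Ma.
split=> //; first exact: subset_trans UU'.
by move=> p /cU'[/cU//|[_ Mp]]; right.
Qed.

(** A condition on neighbourhoods, because a path in [H] may run through boundary points of [Omega],
    which are never reachable themselves. *)
Definition reachable_near h :=
  exists W, [/\ open W, W h & W `&` Omega `<=` reachable].

Definition unreachable_near h :=
  exists W, [/\ open W, W h & W `&` Omega `<=` ~` reachable].

(* Near [h] all points of [Omega] see a common point of [Omega `&` O], so that
   either all of them are reachable or none is. *)
Lemma reachable_near_dichotomy h : closure Omega h -> O h ->
  reachable_near h \/ unreachable_near h.
Proof.
move=> cOh Oh; have [oOm _ sOm] := sOmega.
have [q sq] := sOm h.
have [s0 /andP[s00 _] /(_ s0)] := star_near_small_tube _ _ _ _ cOh sq oO Oh.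
rewrite lexx s00 => /(_ isT)[Oq1 [d d0 Hd]]; set q1 := h + _ in Oq1 Hd.
have inM w t : tube h q1 d w -> Omega w -> 0 <= t <= 1 -> (Omega `&` O) (w + t *: (q1 - w)).
  move=> tw Ow t01; have tw' : tube h q1 d (w + t *: (q1 - w)).
    by apply: tube_convex => //; exact: tuber.
  split; last by have [] := Hd _ tw'.
  have [_ [e e0 He]] := Hd _ tw.
  by apply: He => //; rewrite subrr normr0.
have [Rq1|nRq1] := pselect (reachable q1).
  left; exists (tube h q1 d); split; [exact: tube_open|exact: tubel|].
  by move=> w [tw Ow]; apply: reachable_segment Rq1 => t; exact: inM.
right; exists (tube h q1 d); split; [exact: tube_open|exact: tubel|].
move=> w [tw Ow] Rw; apply: nRq1; apply: reachable_segment Rw => t /andP[t0 t1].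
have -> : q1 + t *: (w - q1) = w + (1 - t) *: (q1 - w).
  by apply/rowP => i; rewrite !mxE; ring.
by apply: inM => //; lra.
Qed.

Lemma reachable_near_open : open reachable_near.
Proof.
rewrite openE => h [W [oW Wh HW]].
by apply: filterS (open_nbhs_nbhs (conj oW Wh)) => w Ww; exists W.
Qed.

Lemma unreachable_near_open : open unreachable_near.
Proof.
rewrite openE => h [W [oW Wh HW]].
by apply: filterS (open_nbhs_nbhs (conj oW Wh)) => w Ww; exists W.
Qed.

(** On [C] the two alternatives are open, exhaustive and mutually exclusive, so connectedness leaves
    only one. *)
Lemma reachable_near_connected C z x : connected C ->
  C `<=` closure Omega `&` O -> C z -> C x ->
  reachable_near z -> reachable_near x.
Proof.
move=> cC CH Cz Cx Rz.
suff CE : C `&` reachable_near = C by move: Cx; rewrite -CE => -[].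
apply: cC; first by exists z.
  by exists reachable_near => //; exact: reachable_near_open.
exists (~` unreachable_near).
  by apply: open_closedC; exact: unreachable_near_open.
apply/seteqP; split=> h [Ch Rh]; split=> //.
  move=> [W [oW Wh WR]]; have [W' [oW' Wh' WR']] := Rh.
  have [cOh _] := CH h Ch.
  (* As [h] lies in [closure Omega], the two neighbourhoods share a point of [Omega], which would be
     both reachable and not. *)
  have [w [Ow [Ww Ww']]] := cOh _ (filterI (open_nbhs_nbhs (conj oW Wh))
    (open_nbhs_nbhs (conj oW' Wh'))).
  by apply: (WR w) => //; apply: WR'.
have [cOh Oh] := CH h Ch.
by have [//|] := reachable_near_dichotomy h cOh Oh.
Qed.

(** A reachable [b] is chosen near [x] such that the segment from [x] to [b] lies in [Omega] except
    for [x]. The domain that reaches [b] has [x] off its closure, so the segment from [x] first hits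
    that closure inside [Omega]. *)
Lemma star_domain_reach_boundary x : closure Omega x -> ~ Omega x -> O x ->
  ~ closure U0 x -> reachable_near x ->
  exists U W, [/\ star_domain U, U0 `<=` U, U `<=` Omega,
    closure U `<=` closure U0 `|` (closure Omega `&` O) &
    [/\ open W, W x & W `&` Omega `<=` U]].
Proof.
move=> cOx nOx Ox nU0x [W [oW Wx WR]]; have [oOm _ sOm] := sOmega.
have [q sq] := sOm x.
have [s0 /andP[s00 s01] Hs] :=
  star_near_small_tube _ _ _ _ cOx sq (openI oO oW) (conj Ox Wx).
pose b := x + s0 *: (q - x).
have segE t : x + t *: (b - x) = x + (t * s0) *: (q - x).
  by apply/rowP => i; rewrite !mxE; ring.
have inO t : 0 < t <= 1 -> Omega (x + t *: (b - x)).
  move=> /andP[t0 t1]; rewrite segE.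
  by have [|] := Hs (t * s0); first by rewrite mulr_gt0//=; nra.
have [Ob' [d d0 Hd]] : Omega b /\ exists2 d : R, 0 < d &
      forall p, tube x b d p -> (O `&` W) p /\ star_near Omega p b.
  by apply: Hs; rewrite s00 lexx.
have [_ [U [sU U0U UO cU] Ub]] : reachable b.
  by apply: WR; split=> //; have [[_ ?] _] := Hd _ (tuber x b d d0).
have nUx : ~ closure U x by move=> /cU[//|[]].
have [|||U' [W' [sU' UU' U'O cU' HW']]] :=
  star_domain_attach Omega O U x b oOm sU UO Ub oO.
- move=> t t01; have [|[]//] := Hd (x + t *: (b - x)); exact: tube_segment.
- move=> t /andP[t0 t1] Ut; apply: inO; rewrite t1 andbT lt_neqAle t0 andbT.
  by apply/eqP => t00; apply: nUx; move: Ut; rewrite -t00 scale0r addr0.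
- move=> t /andP[t0 t1] Ot.
  have tgt0 : 0 < t.
    rewrite lt_neqAle t0 andbT; apply/eqP => t00.
    by apply: nOx; move: Ot; rewrite -t00 scale0r addr0.
  (* The moving target on the segment to [b] has parameter [t * s0 <= s0] on the segment to [q]. *)
  rewrite segE; have [|_ [f f0 Hf]] := Hs (t * s0).
    by rewrite mulr_gt0//=; nra.
  by exists f => // p /Hf[].
exists U', W'; split=> //; first exact: subset_trans UU'.
by move=> p /cU'[/cU[Up|[/subset_closure Op Oop]]|Op]; [left|right|right].
Qed.

End reachable.

(** * Suitable domains at the points of [H], and a countable choice among them *)

Section main.
Context {R : realType} {n : nat}.
Implicit Types (Omega D O W : set 'rV[R]_n.+1).

(** [D] has positive measure around [z], and [U0] agrees with [Omega] near [z]. Every domain grown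
    from [U0] contains it, so the measure condition persists while the path carries reachability
    from [z] to [x]. *)
Lemma star_domain_at Omega D O x : star_domain Omega ->
  D `<=` boundary Omega -> open O ->
  admissible D (closure Omega `&` O) -> closure Omega x -> O x ->
  exists U, [/\ star_domain U, U !=set0, U `<=` Omega,
    closure U `<=` closure Omega `&` O &
    (exists W, [/\ open W, W `&` Omega `<=` U & (0 < hausdorff_measure n (W `&` D))%E]) /\
    (exists W, [/\ open W, W x & W `&` Omega `<=` U])].
Proof.
move=> sOm Dsub oO adm cOx Ox; have oOm : open Omega by case: sOm.
have [z [[g [cg g0 g1 gH]] Dz] Hz] := hausdorff_support _ _ _ _ (adm x (conj cOx Ox)).
have HD W : open W -> W z -> (0 < hausdorff_measure n (W `&` D))%E.
  move=> oW Wz; apply: lt_le_trans (Hz W oW Wz) _.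
  by apply: le_hausdorff_measure => w [Ww [_ Dw]].
have [cOz Oz] : (closure Omega `&` O) z by rewrite -g1; apply: gH; rewrite in_itv/= ler01 lexx.
have [xz|/eqP xz] := eqVneq x z.
  have [U [W [sU U0 UO cU [oW Wz WU]]]] := star_domain_corner Omega O z sOm cOz oO Oz.
  exists U; split=> //.
    by move=> p Up; split; [exact: closure_subset Up|exact: cU].
  by split; exists W; rewrite ?xz; split=> //; exact: HD.
have xz0 : 0 < `|x - z| by rewrite normr_gt0 subr_eq0; apply/eqP.
(* The ball, whose radius is the distance of [x] and [z], keeps [x] off [closure U0]. *)
have [||U0 [W [sU0 U00 U0O cU0 [oW Wz WU0]]]] :=
  star_domain_corner Omega (O `&` [set w | `|w - z| < `|x - z|]) z sOm cOz.
- by apply: openI => //; exact: norm_ball_open.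
- by split=> //=; rewrite subrr normr0.
have cU0H : closure U0 `<=` closure Omega `&` O.
  by move=> p Up; split; [exact: closure_subset Up|have [] := cU0 _ Up].
have nU0x : ~ closure U0 x by move=> /cU0[_ /=]; rewrite ltxx.
have Rz : reachable_near Omega O U0 z.
  exists (W `&` O); split; [exact: openI|by []|].
  move=> w [[Ww Ow] Omw]; split=> //; exists U0; last exact: WU0.
  by split=> // p Up; left.
have Rx : reachable_near Omega O U0 x.
  have cC : connected (g @` `[0, 1]).
    by apply: connected_continuous_connected => //; exact: segment_connected.
  apply: (reachable_near_connected Omega O U0 sOm oO _ z x cC) => //.
  - by move=> _ [t t01 <-]; apply: gH; rewrite inE.
  - by exists 1 => //=; rewrite in_itv/= ler01 lexx.
  - by exists 0 => //=; rewrite in_itv/= ler01 lexx.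
have U0ne U : U0 `<=` U -> U !=set0 by move=> U0U; have [u /U0U] := U00; exists u.
have HDU U : U0 `<=` U ->
    exists W, [/\ open W, W `&` Omega `<=` U & (0 < hausdorff_measure n (W `&` D))%E].
  by move=> U0U; exists W; split=> //; [exact: subset_trans U0U|exact: HD].
have [Omx|nOmx] := pselect (Omega x).
  have [W' [oW' Wx' WR]] := Rx.
  have [_ [U [sU U0U UO cU] Ux]] := WR x (conj Wx' Omx).
  exists U; split=> //; first exact: U0ne.
    by move=> p /cU[/cU0H//|[/subset_closure]].
  split; first exact: HDU.
  by exists U; split=> //; case: sU.
have [U [W' [sU U0U UO cU HW']]] :=
  star_domain_reach_boundary Omega O U0 sOm oO x cOx nOmx Ox nU0x Rx.
exists U; split=> //; first exact: U0ne.
  by move=> p /cU[/cU0H|].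
by split; [exact: HDU|exists W'].
Qed.

(** Inside [W] the sets [U] and [Omega] coincide, and boundary points of the open set [Omega] lie
    outside it. *)
Lemma sub_boundary Omega U W : open Omega -> open W -> U `<=` Omega ->
  W `&` Omega `<=` U -> W `&` boundary Omega `<=` boundary U.
Proof.
move=> oO oW UO WU p [Wp [cp nip]]; split.
  move=> N Np; have [w [Ow [Nw Ww]]] := cp _ (filterI Np (open_nbhs_nbhs (conj oW Wp))).
  by exists w; split=> //; exact: WU.
by move=> /interior_subset/UO Op; apply: nip; rewrite (interior_id Omega).1.
Qed.

Lemma closure_bounded (A : set 'rV[R]_n.+1) : bounded_set A -> bounded_set (closure A).
Proof.
move=> [M [Mr HM]]; exists (M + 1); split; first exact: num_real.
move=> k Mk p /closure_ballP/(_ ((k - (M + 1)) / 2))[|w Aw wp]; first by rewrite divr_gt0 ?subr_gt0.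
have : `|w| <= M + 1 + (k - (M + 1)) / 2 by apply: HM => //; lra.
have : `|p| <= `|w| + `|w - p| by have := ler_distD w p 0; rewrite !subr0 (distrC p w); lra.
by rewrite /=; lra.
Qed.

End main.

Theorem lemma4p5 (R : realType) (n : nat) (Omega D H : set 'rV[R]_n.+1)
  (Omega_lip : lipschitz_domain Omega) (Omega_bnd : bounded_set Omega)
  (D_sub : D `<=` boundary Omega) (D_pos : (0 < hausdorff_measure n D)%E)
  (H_open : relatively_open Omega H) (H_adm : admissible D H)
  (H_neq0 : H !=set0) :
  exists U : (set 'rV[R]_n.+1)^nat,
    [/\ fine_representation Omega H U,
        forall m, lipschitz_domain (U m) &
        forall m, (0 < hausdorff_measure n (boundary (U m) `&` D))%E].
Proof.
have sOm := lipschitz_star_domain _ Omega_lip.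
have oOm : open Omega by case: sOm.
have [N oN HE] := H_open.
have adm : admissible D (closure Omega `&` N) by rewrite -HE.
pose good U := [/\ star_domain U, U !=set0, closure U `<=` H &
  (0 < hausdorff_measure n (boundary U `&` D))%E].
have good_at x : H x -> exists2 U, good U &
    exists W, [/\ open W, W x & W `&` Omega `<=` U].
  rewrite HE => -[cOx Ox].
  have [U [sU Une UO cU [[W [oW WU WD]] Wx]]] :=
    star_domain_at Omega D N x sOm D_sub oN adm cOx Ox.
  exists U => //; split=> //; first by rewrite HE.
  apply: lt_le_trans WD _; apply: le_hausdorff_measure => w [Ww Dw].
  by split=> //; apply: (sub_boundary Omega U W) => //; split=> //; exact: D_sub.
(* An empty [H] contains the closure of no nonempty set; a point of [H] supplies the default domain
   [Ux0]. *)
have [x0 Hx0] := H_neq0; have [Ux0 gUx0 _] := good_at x0 Hx0.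
(* Indexing by basic balls makes the family countable: if the part of [Omega] in ball [k] fits into
   some good domain, [U k] is such a domain, otherwise the default. *)
have [U HU] : {U : nat -> set 'rV[R]_n.+1 & forall k, good (U k) /\
    ((exists2 U', good U' & rational_ball k `&` Omega `<=` U') ->
     rational_ball k `&` Omega `<=` U k)}.
  apply: (@choice _ _ (fun k U => good U /\
    ((exists2 U', good U' & rational_ball k `&` Omega `<=` U') ->
     rational_ball k `&` Omega `<=` U))) => k.
  have [[U' gU' kU']|nU'] :=
    pselect (exists2 U', good U' & rational_ball k `&` Omega `<=` U').
    by exists U'.
  by exists Ux0.
exists U; split.
- split=> [k|x Hx].
    have [[[oU _ _] _ cU _] _] := HU k; split=> //; split=> //.
    (* Boundedness is inherited from [closure Omega], which contains [H]. *)
    apply: bounded_closed_compact; last exact: closed_closure.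
    have cUO : closure (U k) `<=` closure Omega by move=> p /cU; rewrite HE => -[].
    have [M [Mr HM]] := closure_bounded _ Omega_bnd.
    by exists M; split=> // r Mr' p /cUO; exact: HM.
  have [U' gU' [W [oW Wx WU']]] := good_at x Hx.
  have [k kx kW] := rational_ball_base _ _ oW Wx.
  exists (rational_ball k), k; split=> //; first exact: rational_ball_open.
  apply: (HU k).2.
  by exists U' => // p [kp Op]; apply: WU'; split=> //; exact: kW.
- by move=> m; have [[sU Une _ _] _] := HU m; exact: star_lipschitz_domain.
- by move=> m; have [[_ _ _ ?] _] := HU m.
Qed.
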